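(* Let $\alpha$ be a composition of $n$. Then $$\mathcal{RS}_{\alpha}=\sum_{\beta} d_{\alpha\beta}F_{\beta},$$ where the sum is over compositions $\beta$ of $n$ and $d_{\alpha\beta}$ is the number of standard row-strict composition tableaux $F$ of shape $\alpha$ with $\bm{\beta}(D'(F))=\beta$.
   Context: A composition $\alpha=(\alpha_1,\ldots,\alpha_l)$ of $n$ is a finite sequence of positive integers summing to $n$. Its diagram has $l$ rows of left-justified cells, the $i$-th row from the top having $\alpha_i$ cells. Let $m$ be the largest part of $\alpha$. A row-strict composition tableau (RSCT) $F$ of shape $\alpha$ is a filling of the diagram with positive integers such that (1) entries strictly decrease in each row from left to right; (2) entries in the leftmost column weakly increase from top to bottom; (3) if $\hat F$ is the $l\times m$ array obtained from $F$ by adding cells with entry $0$ to the end of each row, then for $1\le i<j\le l$, $2\le k\le m$: $\hat F(j,k)>\hat F(i,k)$ implies $\hat F(j,k)\ge\hat F(i,k-1)$ (where $\hat F(i,j)$ is the entry in row $i$, column $j$). The weight is $x^F=\prod_i x_i^{w_i(F)}$ with $w_i(F)$ the number of occurrences of $i$ in $F$, and $\mathcal{RS}_\alpha=\sum_F x^F$ over all RSCTs $F$ of shape $\alpha$. An RSCT with $n$ cells is standard if $x^F=x_1x_2\cdots x_n$. For a standard RSCT $F$ with $n$ cells, the transpose descent set $D'(F)$ is the set of all $i\in\{1,\ldots,n-1\}$ such that $i+1$ appears in a column strictly to the left of the column containing $i$. For a set $S=\{s_1<s_2<\cdots<s_k\}\subseteq\{1,\ldots,n-1\}$, $\bm{\beta}(S)=(s_1,s_2-s_1,\ldots,s_k-s_{k-1},n-s_k)$,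 with $\bm\beta(\emptyset)=(n)$. $M_\beta=\sum_{i_1<\cdots<i_r}x_{i_1}^{\beta_1}\cdots x_{i_r}^{\beta_r}$ for $\beta=(\beta_1,\ldots,\beta_r)$, and Gessel's fundamental quasisymmetric function is $F_\beta=\sum_{\gamma\preceq\beta}M_\gamma$, where $\gamma\preceq\beta$ means $\beta$ is obtained from $\gamma$ by summing some adjacent parts. *)

(* Defs.v *)
From HB Require Import structures.
From mathcomp Require Import all_boot all_order all_algebra finmap multiset.
From mathcomp Require Import boolp classical_sets functions cardinality fsbigop.

Set Implicit Arguments.
Unset Strict Implicit.
Unset Printing Implicit Defensive.

Import Order.TTheory GRing.Theory.

Local Open Scope classical_set_scope.
Local Open Scope ring_scope.

(* A monomial in x_1, x_2, ... is the multiset of the indices of its variables: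
   x_i has exponent m i in m. A series over int maps each monomial to its
   coefficient, so 0, + and *+ are the pointwise ones of functions. The variable
   x_0, which indices in nat also allow, occurs in none of the series below. *)
Notation monomial := ({mset nat}%mset).
Definition series := monomial -> int.

Definition monom (m : monomial) : series := fun m' => (m' == m)%:R.

(* The sum of a family of series in which every monomial has a nonzero
   coefficient only finitely many times; finite_RSCT_monom and finite_mqs_monom
   show that the families used below are such. *)
Definition series_sum (I : choiceType) (A : set I) (f : I -> series) : series :=
  fun m => \sum_(i \in A) f i m.

Definition is_composition (n : nat) (a : seq nat) : bool :=
  all (leq 1) a && (sumn a == n).

(* The parts of b are the sums of the blocks of a cutting of c into blocks of
   adjacent parts. *)
Definition refines (c b : seq nat) : Prop :=
  exists ss : seq (seq nat),
    [/\ [::] \notin ss, flatten ss = c & map sumn ss = b].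

Definition increasing_indices (r : nat) : set (seq nat) :=
  [set s | [/\ size s = r, all (leq 1) s & sorted ltn s]].

(* x_{s_1}^{b_1} ... x_{s_r}^{b_r} *)
Definition power_monomial (b s : seq nat) : monomial :=
  seq_mset (flatten [seq nseq p.2 p.1 | p <- zip s b]).

Definition monomial_qsym (b : seq nat) : series :=
  series_sum (increasing_indices (size b))
             (fun s => monom (power_monomial b s)).

Definition fundamental_qsym (b : seq nat) : series :=
  \sum_(c \in [set c | is_composition (sumn b) c /\ refines c b])
    monomial_qsym c.

(* A filling is the list of its rows, from top to bottom, and its shape is the
   library's shape (the sizes of its rows). Rows and columns are numbered from
   0 here. *)
Definition filling := seq (seq nat).

(* The array obtained by padding the rows of F with zeros. *)
Definition padded (F : filling) (i k : nat) : nat := nth 0%N (nth [::] F i) k.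

Definition triple_rule (a : seq nat) (F : filling) : Prop :=
  forall i j k : nat, (i < j < size a)%N -> (0 < k < \max_(p <- a) p)%N ->
    (padded F i k < padded F j k)%N -> (padded F i k.-1 <= padded F j k)%N.

Definition RSCT (a : seq nat) : set filling :=
  [set F | [/\ shape F = a,
               all (all (leq 1)) F,
               all (sorted gtn) F,
               sorted leq [seq head 0%N r | r <- F]
             & triple_rule a F]].

Definition weight (F : filling) : monomial := seq_mset (flatten F).

Definition RS (a : seq nat) : series :=
  series_sum (RSCT a) (fun F => monom (weight F)).

Definition standard (F : filling) : Prop :=
  weight F = seq_mset (iota 1 (sumn (shape F))).

Definition in_column (F : filling) (k x : nat) : Prop :=
  exists i, [/\ (i < size F)%N, (k < size (nth [::] F i))%N & padded F i k = x].

Definition transpose_descents (n : nat) (F : filling) : {fset nat} :=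
  [fset i in iota 1 n.-1 |
    `[< exists k k', [/\ in_column F k i, in_column F k' i.+1 & (k' < k)%N] >]]%fset.

(* For n = 0 the formula (s_1, s_2 - s_1, ..., n - s_k) would give (0), which is
   not a composition; the value is then the empty composition. *)
Definition composition_of_set (n : nat) (S : {fset nat}) : seq nat :=
  if n == 0%N then [::]
  else pairmap (fun s t => (t - s)%N) 0%N (rcons (sort leq S) n).

Definition dset (a b : seq nat) : set filling :=
  [set F | [/\ RSCT a F, standard F
             & composition_of_set (sumn a)
                 (transpose_descents (sumn a) F) = b]].

Definition dcoef (a b : seq nat) : nat := #|` fset_set (dset a b)|.

(* \sum_(i \in A) and fset_set are 0 and fset0 when the support or the set is
   infinite; the lemmas below show that this does not happen above. *)

Lemma finite_compositions (n : nat) : finite_set [set b | is_composition n b].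
Proof.
pose f (u : {k : 'I_n.+1 & k.-tuple 'I_n.+1}) : seq nat :=
  map val (val (tagged u)).
apply: (@sub_finite_set _ _ (f @` setT)); last first.
  exact/finite_image/finite_finset.
move=> b /= /andP[b_gt0 /eqP sb].
have szb : (size b < n.+1)%N.
  rewrite ltnS -sb; elim: (b) b_gt0 => //= x s IHs /andP[x0 /IHs].
  by rewrite -add1n => /(leq_add x0).
have leb x : x \in b -> (x < n.+1)%N.
  move=> xb; rewrite ltnS -sb; elim: (b) xb => //= y s IHs.
  rewrite inE => /predU1P[->|/IHs]; first exact: leq_addr.
  by move=> h; apply: leq_trans h _; exact: leq_addl.
have szt : size [seq inord x : 'I_n.+1 | x <- b] == Ordinal szb.
  by rewrite size_map.
exists (existT _ (Ordinal szb) (Tuple szt)) => //.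
rewrite /f /= -map_comp -[RHS]map_id; apply/eq_in_map => x xb /=.
by rewrite inordK ?leb.
Qed.

Lemma finite_RSCT_weight (a : seq nat) (m : monomial) :
  finite_set (RSCT a `&` [set F | weight F = m]).
Proof.
apply: (@sub_finite_set _ _ ((fun s : seq nat => reshape a s) @` [set` permutations (m : seq nat)])); last first.
  exact/finite_image/finite_seq.
move=> F /= [[shF _ _ _ _] <-]; exists (flatten F); last first.
  by rewrite -shF flattenK.
by rewrite /= mem_permutations perm_sym /weight perm_eq_seq_mset.
Qed.

Lemma finite_RSCT_monom (a : seq nat) (m : monomial) :
  finite_set (RSCT a `&` (fun F => monom (weight F) m) @^-1` [set~ 0]).
Proof.
apply: sub_finite_set (finite_RSCT_weight a m) => F [aF] /= nz.
split=> //=; apply/esym/eqP; apply: contra_notT nz => /negbTE.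
by rewrite /monom => ->.
Qed.

Lemma finite_mqs_monom (b : seq nat) (m : monomial) : all (leq 1) b ->
  finite_set (increasing_indices (size b) `&`
              (fun s => monom (power_monomial b s) m) @^-1` [set~ 0]).
Proof.
move=> b_gt0; apply: (@sub_finite_set _ _ [set sort leq (undup m)]).
  move=> s [[szs _ s_lt]] /= nz.
  have -> : m = power_monomial b s.
    by apply/eqP; apply: contra_notT nz => /negbTE; rewrite /monom => ->.
  apply: (irr_sorted_eq ltn_trans ltnn) => //.
    rewrite ltn_sorted_uniq_leq sort_uniq undup_uniq /=.
    exact: (sort_sorted leq_total).
  move=> x; rewrite mem_sort mem_undup (perm_mem (perm_eq_seq_mset _)).
  elim: s b szs b_gt0 {s_lt nz} => [|y s IHs] [|k b] //= [/IHs {}IHs].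
  move=> /andP[k0 /IHs {}IHs].
  by rewrite mem_cat inE -IHs mem_nseq k0.
exact: finite_set1.
Qed.

Lemma finite_dset (a b : seq nat) : finite_set (dset a b).
Proof.
apply: sub_finite_set (finite_RSCT_weight a (seq_mset (iota 1 (sumn a)))).
by move=> F [aF stF _]; split=> //=; rewrite stF; case: aF => ->.
Qed.

(* Main.v *)
Require Import Defs.
From mathcomp Require Import zify.
From mathcomp Require Import all_boot all_order all_algebra finmap multiset.
From mathcomp Require Import boolp classical_sets functions cardinality fsbigop.

(** The identity is proved coefficient by coefficient, by standardization.

    Fix a monomial [m] of degree n. Given a tableau F of weight [m], list its
    cells by increasing entry, ordering equal entries by column from left to
    right and, inside a column, downwards in the leftmost column and upwards in
    the others. Numbering the cells 1, ..., n along this list gives a standard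
    tableau T of the same shape ([standardization_RSCT]), and F is recovered
    from T by replacing x with the x-th smallest letter of [m]
    ([standardizationK]). Equal entries are numbered from left to right, so if
    x is a transpose descent of T, then the letters number x and x + 1 of [m]
    differ ([standardization_compatible]).

    Conversely, let T be standard and suppose that the letters of [m] strictly
    increase at all transpose descents of T. Entries of T that receive the same
    letter then move weakly to the right as they grow ([column_homo]), which
    makes the destandardized filling row-strict ([destandardization_RSCT]) and,
    together with the triple rule, forces T to order its cells as above
    ([standard_order]), so that T is determined by its destandardization
    ([destandardization_inj]).

    Hence the coefficient of [m] on the left counts the standard tableaux whose
    transpose descents are strict ascents of the sorted word of [m]
    ([RS_coef]). On the right, the fundamental quasisymmetric function of a
    composition has coefficient 1 at [m], if x_0 does not divide [m] and the
    exponents of [m] refine the composition, and 0 otherwise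
    ([fundamental_qsym_coef]). For the composition of a descent set these two
    conditions agree ([refines_exponents]): cuts between blocks of equal letters
    are exactly the strict ascents. *)

Local Open Scope nat_scope.

(** * Refinement of compositions and partial sums *)

(** A composition is determined by its partial sums; refinement is inclusion of
    these sets, and the composition of a set is the one that has it, together
    with 0 and the total, as its partial sums. *)
Definition psum (c : seq nat) (y : nat) : Prop := exists k, y = sumn (take k c).

Lemma psum0 c : psum c 0.
Proof. by exists 0; rewrite take0. Qed.

Lemma psum_cons d c y :
  psum (d :: c) y <-> y = 0 \/ exists2 z, psum c z & y = d + z.
Proof.
split=> [[[|k] ->]|[->|[_ [k ->] ->]]]; first by left.
- by right; exists (sumn (take k c)) => //; exists k.
- exact: psum0.
- by exists k.+1.
Qed.

(** A cut of the coarser composition falls between two blocks, hence is also a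
    cut of the finer one. *)
Lemma psum_refines c b : refines c b -> forall y, psum b y -> psum c y.
Proof.
case=> ss [_ <- <-] y [k ->]; elim: ss k => [|s ss IH] [|k] /=; do ?exact: psum0.
have [l ->] := IH k; exists (size s + l).
by rewrite take_cat ltnNge leq_addr /= addKn sumn_cat.
Qed.

(** The converse: the first part [d] of [b], being a partial sum of [c], is the
    sum of an initial run of parts of [c], which is cut off as the first block;
    the remaining partial sums of [b] are then partial sums of what is left. *)
Lemma refines_psum c b : all (leq 1) c -> all (leq 1) b -> sumn c = sumn b ->
  (forall y, psum b y -> psum c y) -> refines c b.
Proof.
elim: b c => [|d b IH] c.
  case: c => [|x c] /=; last by case/andP; case: x.
  by exists [::].
move=> cp /= /andP[dp bp] sc bc.
have [k dk] : psum c d.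
  by apply: bc; apply/psum_cons; right; exists 0; [exact: psum0|rewrite addn0].
have ck : c = take k c ++ drop k c by rewrite cat_take_drop.
have [||||ss [ss0 sc' sb]] := IH (drop k c).
- by move: cp; rewrite {1}ck all_cat => /andP[].
- by [].
- by move: sc; rewrite {1}ck sumn_cat -dk => /addnI.
- move=> y yb; have [l yl] : psum c (d + y).
    by apply: bc; apply/psum_cons; right; exists y.
  exists (l - k); move: yl; case: (leqP k l) => kl.
    rewrite -{1}(subnKC kl) takeD sumn_cat -dk; exact: addnI.
  (* Here the partial sum [d + y] of [c] does not exceed [d], so [y] is 0. *)
  rewrite (eqP (ltnW kl : l - k == 0)) take0.
  have : sumn (take l c) <= sumn (take k c).
    by rewrite -(subnKC (ltnW kl)) takeD sumn_cat leq_addr.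
  rewrite /=; lia.
exists (take k c :: ss); split => /=.
- rewrite inE negb_or ss0 andbT; apply/eqP => k0.
  by move: dp; rewrite dk -k0.
- by rewrite sc' cat_take_drop.
- by rewrite -dk sb.
Qed.

(** Summing the successive differences of an increasing list telescopes. *)
Lemma psum_gaps x s y : path leq x s ->
  psum (pairmap (fun s t => t - s) x s) y <-> x + y \in x :: s.
Proof.
elim: s x y => [|t s IH] x y /=.
  rewrite mem_seq1 => _; split=> [[k ->]|]; first by rewrite addn0.
  by rewrite -{2}(addn0 x) eqn_add2l => /eqP->; exact: psum0.
move=> /andP[xt ts]; split.
  case/psum_cons => [->|[z /(IH _ _ ts) zs ->]]; first by rewrite addn0 mem_head.
  by rewrite in_cons addnA subnKC // zs orbT.
rewrite in_cons => /orP[|yts].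
  by rewrite -{2}(addn0 x) eqn_add2l => /eqP->; exact: psum0.
have ty : t <= x + y.
  move: yts; rewrite in_cons => /orP[/eqP<- //|].
  by move/allP: (order_path_min leq_trans ts); apply.
apply/psum_cons; right; exists (x + y - t); last lia.
by apply/(IH _ _ ts); rewrite subnKC.
Qed.

Lemma psum_composition_of_set n (S : {fset nat}) y :
  {in S, forall x, 0 < x < n} ->
  psum (composition_of_set n S) y <-> [\/ y = 0, y = n | y \in S].
Proof.
move=> Sn; rewrite /composition_of_set; case: eqP => [n0|_].
  split=> [[k ->]|[->|->|/Sn]]; [by constructor|exact: psum0|rewrite n0; exact: psum0|].
  lia.
have ps : path leq 0 (rcons (sort leq S) n).
  rewrite rcons_path; apply/andP; split.
    by rewrite path_min_sorted ?(sort_sorted leq_total) //; apply/allP.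
  have := mem_last 0 (sort leq S); rewrite in_cons mem_sort => /orP[/eqP-> //|].
  by move/Sn => /andP[_ /ltnW].
rewrite (psum_gaps _ _ _ ps) add0n in_cons mem_rcons in_cons mem_sort.
split=> [/or3P[/eqP|/eqP|]|[->|->|->]]; rewrite ?eqxx ?orbT //; by constructor.
Qed.

Lemma composition_of_setP n (S : {fset nat}) :
  {in S, forall x, 0 < x < n} -> is_composition n (composition_of_set n S).
Proof.
move=> Sn; rewrite /composition_of_set; case: eqP => [-> //|/eqP]; rewrite -lt0n => n0.
have ps : path ltn 0 (rcons (sort leq S) n).
  rewrite rcons_path; apply/andP; split.
    rewrite path_min_sorted; last by apply/allP => x; rewrite mem_sort => /Sn/andP[].
    by rewrite ltn_sorted_uniq_leq sort_uniq fset_uniq (sort_sorted leq_total).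
  have := mem_last 0 (sort leq S).
  by rewrite in_cons mem_sort => /orP[/eqP lS|/Sn/andP[]]; rewrite /= ?lS.
suff gaps x s : path ltn x s ->
    [/\ x <= last x s, all (leq 1) (pairmap (fun s t => t - s) x s)
      & sumn (pairmap (fun s t => t - s) x s) = last x s - x].
  have [_ p1 p2] := gaps _ _ ps.
  by rewrite /is_composition p1 p2 last_rcons subn0 eqxx.
elim: s x => [|t s IH] x /=; first by rewrite subnn.
move=> /andP[xt /IH[tl -> ->]]; rewrite subn_gt0 xt; split=> //; lia.
Qed.

(** * Monomials as sorted words *)

(** The monomial [m] is x_{s_1}^{c_1} ... x_{s_r}^{c_r} with [s] its variables and
    [c] its exponents; this is the only way to write it so with [s] increasing
    and [c] positive. *)
Definition variables (m : monomial) : seq nat := sort leq (undup m).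
Definition exponents (m : monomial) : seq nat :=
  [seq count_mem x m | x <- variables m].

(** The letters of [m] in weakly increasing order, numbered from 1. The value 0
    at 0 makes the map fix the zeros that pad a filling. *)
Definition letter (m : monomial) (x : nat) : nat := nth 0 (0 :: sort leq m) x.

(** For increasing [s], this is the sorted word of [power_monomial c s]. *)
Definition power_word (c s : seq nat) : seq nat :=
  flatten [seq nseq p.2 p.1 | p <- zip s c].

Lemma mem_power_word c s x : x \in power_word c s -> x \in s.
Proof.
rewrite /power_word; elim: s c => [|y s IH] [|d c] //=; rewrite ?in_nil //.
rewrite mem_cat mem_nseq in_cons => /orP[/andP[_ ->] //|/IH->].
by rewrite orbT.
Qed.

Lemma mem_power_wordE c s : size s = size c -> all (leq 1) c ->
  power_word c s =i s.
Proof.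
move=> sz cp x; rewrite /power_word.
elim: s c sz cp => [|y s IH] [|d c] //= [sz] /andP[dp cp].
by rewrite mem_cat mem_nseq in_cons (IH c) // dp.
Qed.

Lemma count_power_word c s : size s = size c -> uniq s ->
  [seq count_mem x (power_word c s) | x <- s] = c.
Proof.
rewrite /power_word; elim: s c => [|y s IH] [|d c] //= [sz] /andP[ys us].
have /count_memPn y0 : y \notin flatten [seq nseq p.2 p.1 | p <- zip s c].
  by apply: contra ys; exact: mem_power_word.
rewrite count_cat count_nseq /= eqxx mul1n y0 addn0; congr (_ :: _).
rewrite -[RHS](IH _ sz us); apply/eq_in_map => x xs.
rewrite count_cat count_nseq /=; case: eqP => // yx.
by rewrite yx xs in ys.
Qed.

Lemma sorted_power_word c s : sorted ltn s -> sorted leq (power_word c s).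
Proof.
rewrite !sorted_pairwise; [|exact: leq_trans|exact: ltn_trans].
rewrite /power_word; elim: s c => [|y s IH] [|d c] //= /andP[ys us].
rewrite pairwise_cat IH // andbT; apply/andP; split.
  apply/allrelP => u v /nseqP[-> _] /mem_power_word vs.
  by apply: ltnW; move/allP: ys; apply.
by elim: d => //= d ->; rewrite andbT; apply/allP => v /nseqP[-> _].
Qed.

Lemma sort_power_monomial c s : sorted ltn s ->
  sort leq (power_monomial c s) = power_word c s.
Proof.
move=> ss; apply: (sorted_eq leq_trans anti_leq).
- exact: (sort_sorted leq_total).
- exact: sorted_power_word.
- by rewrite perm_sort; exact: perm_eq_seq_mset.
Qed.

Lemma power_monomial_exponents (m : monomial) :
  m = power_monomial (exponents m) (variables m).
Proof.
rewrite -[LHS]seq_mset_id; apply/eq_seq_msetP; rewrite perm_sym.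
have -> : zip (variables m) (exponents m)
          = [seq (x, count_mem x m) | x <- variables m].
  by rewrite /exponents; elim: (variables m) => //= x s ->.
rewrite -map_comp; apply: perm_trans (perm_count_undup m).
by apply/perm_flatten/perm_map; rewrite perm_sort.
Qed.

Lemma variables_sorted m : sorted ltn (variables m).
Proof.
rewrite ltn_sorted_uniq_leq sort_uniq undup_uniq; exact: (sort_sorted leq_total).
Qed.

Lemma exponents_gt0 m : all (leq 1) (exponents m).
Proof.
apply/allP => _ /mapP[x xm ->]; rewrite -has_count has_pred1.
by move: xm; rewrite mem_sort mem_undup.
Qed.

Lemma power_monomialK c s : size s = size c -> all (leq 1) c -> sorted ltn s ->
  variables (power_monomial c s) = s /\ exponents (power_monomial c s) = c.
Proof.
move=> sz cp ss; have pm := perm_eq_seq_mset (power_word c s).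
have sE : variables (power_monomial c s) = s.
  apply: (irr_sorted_eq ltn_trans ltnn (variables_sorted _) ss) => x.
  by rewrite mem_sort mem_undup (perm_mem pm) mem_power_wordE.
split=> //; rewrite /exponents sE.
have us : uniq s by move: ss; rewrite ltn_sorted_uniq_leq => /andP[].
rewrite -[RHS](count_power_word _ _ sz us); apply/eq_map => x.
exact/permP.
Qed.

Lemma sumn_exponents (m : monomial) : sumn (exponents m) = size m.
Proof.
rewrite {2}(power_monomial_exponents m) (perm_size (perm_eq_seq_mset _)).
rewrite size_flatten /shape -map_comp; congr sumn.
by rewrite /exponents; elim: (variables m) => //= x s <-; rewrite size_nseq.
Qed.

(** In the word s_1 ... s_1 s_2 ... s_2 ..., a letter exceeds its predecessor
    exactly where one block of equal letters ends and the next begins. *)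
Lemma psum_power_word c s y : size s = size c -> all (leq 1) c ->
  sorted ltn s -> 0 < y < size (power_word c s) ->
  psum c y <-> nth 0 (power_word c s) y.-1 < nth 0 (power_word c s) y.
Proof.
elim: s c y => [|x s IH] [|d c] y //=; first by rewrite /power_word /=; lia.
move=> [sz] /andP[d0 cp] xs.
have -> : power_word (d :: c) (x :: s) = nseq d x ++ power_word c s by [].
rewrite size_cat size_nseq !nth_cat size_nseq => /andP[y0 yw].
have ss := path_sorted xs.
case: (ltngtP y d) => yd.
- rewrite !nth_nseq yd (leq_ltn_trans (leq_pred y) yd) ltnn; split=> //.
  case/psum_cons => [|[z _]]; lia.
- have -> : (y.-1 < d) = false by lia.
  have -> : y.-1 - d = (y - d).-1 by lia.
  rewrite -IH //; last by lia.
  split=> [/psum_cons[|[z zc ->]]|yc]; [lia|by rewrite addKn|].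
  apply/psum_cons; right; exists (y - d) => //; lia.
- subst y; rewrite prednK // leqnn subnn nth_nseq prednK // leqnn; split=> [_|_]; last first.
    by apply/psum_cons; right; exists 0; [exact: psum0|rewrite addn0].
  have : nth 0 (power_word c s) 0 \in s.
    apply: (mem_power_word c); apply: mem_nth.
    by move: yw; rewrite -{1}(addn0 d) ltn_add2l.
  by move/allP: (order_path_min ltn_trans xs); apply.
Qed.

Lemma psum_exponents (m : monomial) y : 0 < y < size m ->
  psum (exponents m) y <-> letter m y < letter m y.+1.
Proof.
have sE := sort_power_monomial (exponents m) _ (variables_sorted m).
rewrite -power_monomial_exponents in sE => ym.
rewrite (psum_power_word _ (variables m)) ?size_map ?exponents_gt0 ?variables_sorted //.
  by rewrite -sE /letter /=; case: y ym.
by rewrite -sE size_sort.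
Qed.

(** The monomials of the fundamental quasisymmetric function of a set [S] are
    the words x_{i_1} ... x_{i_n} with 1 <= i_1 <= ... <= i_n and strict
    ascents at the places in [S], since the exponents refine the composition of [S] iff
    every element of [S] is a cut between distinct letters. *)
Lemma refines_exponents n (S : {fset nat}) (m : monomial) :
  {in S, forall x, 0 < x < n} ->
  sumn (exponents m) = n /\ refines (exponents m) (composition_of_set n S) <->
  size m = n /\ {in S, forall x, letter m x < letter m x.+1}.
Proof.
move=> Sn; rewrite sumn_exponents; have /andP[bp /eqP sb] := composition_of_setP _ _ Sn.
split=> -[mn H]; split=> //.
  move=> x xS; apply/psum_exponents; first by rewrite mn Sn.
  by apply: (psum_refines _ _ H); apply/psum_composition_of_set => //; constructor.
apply: refines_psum => //; rewrite ?exponents_gt0 ?sumn_exponents ?sb //.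
move=> y /(psum_composition_of_set _ _ _ Sn)[->|->|yS]; first exact: psum0.
  by exists (size (exponents m)); rewrite take_size sumn_exponents.
by apply/psum_exponents; [rewrite mn Sn|exact: H].
Qed.

(** * Fillings as functions on cells *)

(** A filling of a fixed shape is handled as a function on its cells, written
    (row, column). *)
Definition cells (a : seq nat) : seq (nat * nat) :=
  [seq (i, k) | i <- iota 0 (size a), k <- iota 0 (nth 0 a i)].
Definition entry (F : filling) (p : nat * nat) : nat := padded F p.1 p.2.
Definition fill (a : seq nat) (f : nat * nat -> nat) : filling :=
  [seq [seq f (i, k) | k <- iota 0 (nth 0 a i)] | i <- iota 0 (size a)].

Lemma mem_cells a p : (p \in cells a) = (p.2 < nth 0 a p.1).
Proof.
case: p => i k; apply/allpairsPdep/idP => /= [[x [y [_ yx [-> ->]]]]|ki].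
  by move: yx; rewrite mem_iota.
exists i, k; rewrite !mem_iota !add0n ki /=; split=> //.
by case: ltnP => // ai; rewrite nth_default in ki.
Qed.

Lemma cell_row a p : p \in cells a -> p.1 < size a.
Proof.
by rewrite mem_cells; case: (ltnP p.1 (size a)) => // /(nth_default 0)->.
Qed.

Lemma cells_uniq a : uniq (cells a).
Proof.
apply: allpairs_uniq_dep; first exact: iota_uniq.
- by move=> i _; exact: iota_uniq.
- by move=> [i k] [j l] _ _ /= [-> ->].
Qed.

Lemma shape_fill a f : shape (fill a f) = a.
Proof.
rewrite /shape /fill -map_comp -[RHS](mkseq_nth 0) /mkseq.
by apply/eq_map => i /=; rewrite size_map size_iota.
Qed.

Lemma entry_fill a f p : entry (fill a f) p = if p \in cells a then f p else 0.
Proof.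
rewrite mem_cells /entry /padded /fill; case: p => i k /=; case: (ltnP i (size a)) => ia.
  rewrite (nth_map 0) ?size_iota // nth_iota //.
  case: ltnP => ki; last by rewrite nth_default // size_map size_iota.
  by rewrite (nth_map 0) ?size_iota // nth_iota.
by rewrite (nth_default [::]) ?nth_nil ?size_map ?size_iota // (nth_default 0 ia).
Qed.

Lemma entry_default F p : p \notin cells (shape F) -> entry F p = 0.
Proof. by rewrite mem_cells nth_shape -leqNgt => ?; exact: nth_default. Qed.

Lemma fill_entry F : fill (shape F) (entry F) = F.
Proof.
rewrite /fill -[RHS](mkseq_nth [::]) /mkseq size_map; apply/eq_in_map => i.
rewrite mem_iota => /= iF.
rewrite -[RHS](mkseq_nth 0) /mkseq nth_shape.
by apply/eq_map => k.
Qed.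

Lemma flatten_fill a f : flatten (fill a f) = [seq f p | p <- cells a].
Proof.
rewrite /fill /cells map_flatten -map_comp; congr flatten; apply/eq_map => i /=.
by rewrite -map_comp.
Qed.

Lemma flatten_entry F : flatten F = [seq entry F p | p <- cells (shape F)].
Proof. by rewrite -flatten_fill fill_entry. Qed.

Lemma size_cells a : size (cells a) = sumn a.
Proof. by rewrite -(size_map (fun=> 0)) -flatten_fill size_flatten shape_fill. Qed.

Lemma eq_filling F G : shape F = shape G ->
  {in cells (shape F), entry F =1 entry G} -> F = G.
Proof.
move=> sFG eFG; rewrite -[F]fill_entry -[G]fill_entry -sFG.
apply: eq_from_flatten_shape; last by rewrite !shape_fill.
by rewrite !flatten_fill; apply/eq_in_map.
Qed.

Lemma in_columnP F k x : in_column F k x <->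
  exists2 i, (i, k) \in cells (shape F) & entry F (i, k) = x.
Proof.
split=> [[i [_ ki ix]]|[i]].
  by exists i; rewrite // mem_cells nth_shape.
rewrite mem_cells nth_shape /= => ki ix; exists i; split=> //.
by case: ltnP => // /(nth_default [::]) iF; rewrite iF in ki.
Qed.

(** The conditions are read off cell by cell, the form in which they are carried
    along by maps of entries. *)
Lemma RSCTP a F : shape F = a -> RSCT a F <->
  [/\ {in cells a, forall p, 0 < entry F p},
      forall i k, (i, k.+1) \in cells a -> entry F (i, k.+1) < entry F (i, k),
      forall i j, i <= j < size a -> entry F (i, 0) <= entry F (j, 0)
    & triple_rule a F].
Proof.
move=> sF.
have sz : size F = size a by rewrite -sF size_map.
have szr i : nth 0 a i = size (nth [::] F i) by rewrite -sF nth_shape.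
have col i : i < size F -> nth 0 [seq head 0 r | r <- F] i = entry F (i, 0).
  by move=> iF; rewrite (nth_map [::]) // -nth0.
split=> [[_ pF rF cF tF]|[pF rF cF tF]]; split=> //.
- move=> [i k]; rewrite mem_cells /entry /padded /= szr => ki.
  have iF : i < size F.
    by case: ltnP => // /(nth_default [::]) iF; rewrite iF in ki.
  by move/all_nthP: pF => /(_ [::] i iF)/all_nthP-/(_ 0 k ki).
- move=> i k; rewrite mem_cells /entry /padded /= szr => ki.
  have iF : i < size F.
    by case: ltnP => // /(nth_default [::]) iF; rewrite iF in ki.
  by move/all_nthP: rF => /(_ [::] i iF)/sortedP-/(_ 0 k ki).
- move=> i j /andP[ij ja]; rewrite -!col ?sz // ?(leq_ltn_trans ij) //.
  by apply: (sorted_leq_nth leq_trans leqnn 0 cF);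
    rewrite // inE size_map sz ?(leq_ltn_trans ij).
- apply/(all_nthP [::]) => i iF; apply/(all_nthP 0) => k ki.
  by apply: (pF (i, k)); rewrite mem_cells /= szr.
- apply/(all_nthP [::]) => i iF; apply/(sortedP 0) => k ki.
  by apply: (rF i k); rewrite mem_cells /= szr.
- apply/(sortedP 0) => i; rewrite size_map => iF.
  by rewrite !col // ?(ltnW iF) // cF // -sz leqnSn.
Qed.

(** The (reflexive) order in which equal entries are numbered: by columns from
    left to right, so that no transpose descent arises among them; downwards in
    the leftmost column, which has to increase; upwards in every other column k,
    because numbering equal entries at (i, k) and (j, k), i < j, downwards would
    violate the triple rule, the entry at (i, k - 1) being larger than both. *)
Definition before (p q : nat * nat) : bool :=
  (p.2 < q.2) || (p.2 == q.2) && (if p.2 == 0 then p.1 <= q.1 else q.1 <= p.1).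
Definition cell_le (f : nat * nat -> nat) (p q : nat * nat) : bool :=
  (f p < f q) || (f p == f q) && before p q.

Lemma cell_le_total f : total (cell_le f).
Proof.
move=> p q; rewrite /cell_le /before.
by case: (eqVneq p.2 0); case: (eqVneq q.2 0); lia.
Qed.

Lemma cell_le_trans f : transitive (cell_le f).
Proof.
move=> q p r; rewrite /cell_le /before.
by case: (eqVneq p.2 0); case: (eqVneq q.2 0); lia.
Qed.

Lemma cell_le_anti f p q : cell_le f p q -> cell_le f q p -> p = q.
Proof.
case: p q => i k [j l]; rewrite /cell_le /before /=.
case: (eqVneq k 0); case: (eqVneq l 0) => h1 h2 h3 h4;
 (have /eqP -> : i == j by lia); (have /eqP -> : k == l by lia); done.
Qed.

Lemma cell_le_leq f p q : cell_le f p q -> f p <= f q.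
Proof. by rewrite /cell_le; lia. Qed.

Lemma cell_le_column f p q : cell_le f p q -> f p = f q -> p.2 <= q.2.
Proof. by rewrite /cell_le /before => + fpq; rewrite fpq ltnn eqxx; lia. Qed.

(** * Destandardization *)

Lemma uniq_map_inj_in (T1 T2 : eqType) (f : T1 -> T2) (s : seq T1) :
  uniq (map f s) -> {in s &, injective f}.
Proof.
move=> us p q ps qs fpq; have is_ x : x \in s -> index x s < size (map f s).
  by rewrite size_map index_mem.
have := (uniqP (f p) us) (index p s) (index q s) (is_ p ps) (is_ q qs).
rewrite !(nth_map p) ?index_mem // !nth_index // => /(_ fpq) pq.
by rewrite -(nth_index p ps) pq nth_index.
Qed.

Lemma letter_homo (m : monomial) x y :
  x <= y <= size m -> letter m x <= letter m y.
Proof.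
move=> /andP[xy ym]; apply: (sorted_leq_nth leq_trans leqnn).
- by rewrite /= path_min_sorted ?(sort_sorted leq_total) //; apply/allP.
- by rewrite inE /= size_sort ltnS (leq_trans xy).
- by rewrite inE /= size_sort ltnS.
- exact: xy.
Qed.

Definition destandardization (m : monomial) (T : filling) : filling :=
  [seq [seq letter m x | x <- r] | r <- T].

Lemma shape_destandardization m T : shape (destandardization m T) = shape T.
Proof. by rewrite /shape -map_comp; apply/eq_map => r /=; rewrite size_map. Qed.

Lemma entry_destandardization m T p :
  entry (destandardization m T) p = letter m (entry T p).
Proof.
rewrite /entry /padded /destandardization; case: p => i k /=.
case: (ltnP i (size T)) => iT; last by rewrite !(nth_default [::]) ?size_map ?nth_nil.
rewrite (nth_map [::]) //; case: (ltnP k (size (nth [::] T i))) => kT.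
  by rewrite (nth_map 0).
by rewrite !(nth_default 0) ?size_map.
Qed.

Lemma mem_transpose_descents n F x : x \in transpose_descents n F <->
  0 < x < n /\ exists p q,
    [/\ p \in cells (shape F), q \in cells (shape F),
        entry F p = x, entry F q = x.+1 & q.2 < p.2].
Proof.
rewrite /transpose_descents !inE /= mem_iota add1n.
split=> [/andP[xn /asboolP[k [l [/in_columnP[i ik ix] /in_columnP[j jl jx] lk]]]]|].
  by split; [lia|exists (i, k), (j, l)].
move=> [xn [[i k] [[j l] [pF qF px qx lk]]]]; apply/andP; split; first lia.
apply/asboolP; exists k, l; split=> //; apply/in_columnP; [by exists i|by exists j].
Qed.

Section Standard.
Variables (a : seq nat) (T : filling).
Hypotheses (sT : shape T = a) (stT : standard T).

Lemma standard_perm : perm_eq [seq entry T p | p <- cells a] (iota 1 (sumn a)).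
Proof. by rewrite -sT -flatten_entry; apply/eq_seq_msetP. Qed.

Lemma standard_inj : {in cells a &, injective (entry T)}.
Proof.
by apply: uniq_map_inj_in; rewrite (perm_uniq standard_perm) iota_uniq.
Qed.

Lemma standard_range p : p \in cells a -> 0 < entry T p <= sumn a.
Proof.
move=> pa; have := perm_mem standard_perm (entry T p).
by rewrite map_f // mem_iota add1n ltnS => <-.
Qed.

Lemma standard_leq p : entry T p <= sumn a.
Proof.
case: (boolP (p \in cells a)) => [/standard_range/andP[]//|pa].
by rewrite entry_default ?sT.
Qed.

Lemma standard_onto x : 0 < x <= sumn a -> exists2 p, p \in cells a & entry T p = x.
Proof.
move=> xn; have : x \in iota 1 (sumn a) by rewrite mem_iota add1n ltnS.
by rewrite -(perm_mem standard_perm) => /mapP[p pa ->]; exists p.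
Qed.

(** The entries of a standard filling are 1, ..., n, so they are determined by
    their relative order. *)
Lemma standard_entryE p : p \in cells a ->
  entry T p = count (fun q => entry T q <= entry T p) (cells a).
Proof.
move=> /standard_range pn.
rewrite -(count_map (entry T) (fun x => x <= entry T p)) (permP standard_perm).
move: (entry T p) pn => x /andP[_ xn].
rewrite -(subnKC xn) iotaD count_cat.
rewrite (@eq_in_count _ _ predT) => [|y]; last by rewrite mem_iota => /=; lia.
rewrite count_predT size_iota (@eq_in_count _ _ pred0) ?count_pred0 ?addn0 //.
by move=> y; rewrite mem_iota => /=; lia.
Qed.

Variable m : monomial.
Hypotheses (aT : RSCT a T) (sm : size m = sumn a).
Hypothesis jump :
  {in transpose_descents (sumn a) T, forall x, letter m x < letter m x.+1}.

Lemma letter_entry_homo p q :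
  entry T p <= entry T q -> letter m (entry T p) <= letter m (entry T q).
Proof. by move=> pq; apply: letter_homo; rewrite pq sm standard_leq. Qed.

(** Between two entries with the same letter there is no transpose descent, so
    on passing from x to x + 1 one never moves to the left. *)
Lemma column_homo p q : p \in cells a -> q \in cells a ->
  entry T p <= entry T q -> letter m (entry T p) = letter m (entry T q) ->
  p.2 <= q.2.
Proof.
move=> pa; have := standard_range _ pa => /andP[p0 _].
elim: {q}(entry T q) {-2}q (erefl (entry T q)) => [|y IH] q qy qa pq lpq.
  by move: pq; rewrite qy; lia.
move: pq; rewrite leq_eqVlt => /orP[/eqP pq|pq].
  by rewrite (standard_inj _ _ pa qa pq).
have qn := standard_leq q.
have [r ra ry] : exists2 r, r \in cells a & entry T r = y.
  by apply: standard_onto; lia.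
have pr : entry T p <= entry T r by lia.
have lpr := letter_entry_homo _ _ pr.
have lrq : letter m (entry T r) <= letter m (entry T q).
  by apply: letter_entry_homo; lia.
apply: leq_trans (IH r ry ra pr _) _; first by apply/eqP; lia.
rewrite leqNgt; apply/negP => qr.
have : y \in transpose_descents (sumn a) T.
  apply/mem_transpose_descents; split; first lia.
  by exists r, q; rewrite sT.
move/jump; rewrite -qy -ry; lia.
Qed.

(** The order of the cells of [T] can be recovered from its destandardization.
    Only cells with equal letters in a common column need an argument. If such
    cells (i, k) and (j, k), i < j and k > 0, had increasing entries, the triple
    rule would put the entry at (i, k - 1) weakly below that at (j, k); it
    would have the same letter as the smaller entry on its right, contradicting
    [column_homo]. *)
Lemma standard_order p q : p \in cells a -> q \in cells a ->
  entry T p < entry T q -> cell_le (entry (destandardization m T)) p q.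
Proof.
move=> pa qa pq; have lpq := letter_entry_homo _ _ (ltnW pq).
rewrite /cell_le !entry_destandardization.
move: lpq; rewrite leq_eqVlt orbC => /orP[->//|/eqP lpq].
have kl := column_homo _ _ pa qa (ltnW pq) lpq.
rewrite lpq eqxx ltnn /before /=.
move: kl; rewrite leq_eqVlt orbC => /orP[->//|/eqP kl].
have [_ rT cT tT] := (RSCTP _ _ sT).1 aT.
rewrite kl ltnn eqxx /=.
case: p q pa qa pq lpq kl => i k [j l] /= pa qa pq lpq kl; subst l.
case: eqP => k0.
  subst k; rewrite leqNgt; apply/negP => ji.
  have : entry T (j, 0) <= entry T (i, 0).
    apply: cT; rewrite (ltnW ji) /=.
    exact: cell_row pa.
  by rewrite leqNgt pq.
case: k k0 pa qa pq lpq => // k _ pa qa pq lpq.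
rewrite leqNgt; apply/negP => ij.
have ja : j < size a.
  exact: cell_row qa.
have km : 0 < k.+1 < \max_(x <- a) x.
  move: qa; rewrite mem_cells /= => /leq_trans->//.
  apply: leq_bigmax_seq => //; exact: mem_nth.
have ijk := tT i j k.+1.
have {}ijk : entry T (i, k) <= entry T (j, k.+1).
  by apply: ijk => //; rewrite ij.
have ik := rT i k pa.
have pa' : (i, k) \in cells a by move: pa; rewrite !mem_cells /=; lia.
have := column_homo _ _ pa pa' (ltnW ik).
have h1 := letter_entry_homo _ _ ijk; have h2 := letter_entry_homo _ _ (ltnW ik).
rewrite /= ltnn => column; suff: false by []; apply: column.
by apply/eqP; rewrite eqn_leq h2 lpq h1.
Qed.

Lemma destandardization_weight : weight (destandardization m T) = m.
Proof.
rewrite -[RHS]seq_mset_id; apply/eq_seq_msetP.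
rewrite flatten_entry shape_destandardization sT.
rewrite (eq_map (entry_destandardization m T)) map_comp.
apply: perm_trans (perm_map _ standard_perm) _.
suff -> : [seq letter m x | x <- iota 1 (sumn a)] = sort leq m.
  by rewrite perm_sort.
rewrite -sm -(size_sort leq m) (iotaDl 1 0) -map_comp.
exact: (mkseq_nth 0).
Qed.

(** The map on entries is weakly increasing, which preserves the weak
    inequalities of the definition, and the premise of the triple rule reflects
    back to [T]. Rows stay strict by [column_homo]: of two entries with the same
    letter, the larger cannot lie strictly to the left. *)
Lemma destandardization_RSCT : 0 \notin (m : seq nat) ->
  RSCT a (destandardization m T).
Proof.
move=> m0; apply/(RSCTP _ _); first by rewrite shape_destandardization.
have [pT rT cT tT] := (RSCTP _ _ sT).1 aT.
split.
- move=> p pa; rewrite lt0n; apply: contra m0 => /eqP <-.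
  rewrite -{2}destandardization_weight (perm_mem (perm_eq_seq_mset _)).
  rewrite flatten_entry shape_destandardization sT; exact: map_f.
- move=> i k ka; rewrite !entry_destandardization.
  have ik := rT i k ka; have := letter_entry_homo _ _ (ltnW ik).
  have ka' : (i, k) \in cells a by move: ka; rewrite !mem_cells /=; lia.
  have := column_homo _ _ ka ka' (ltnW ik); rewrite /= ltnn; lia.
- by move=> i j ij; rewrite !entry_destandardization; apply/letter_entry_homo/cT.
- move=> i j k ij kn.
  have := letter_entry_homo (j, k) (i, k); have := tT i j k ij kn.
  have := letter_entry_homo (i, k.-1) (j, k).
  rewrite -!(entry_destandardization m) /entry /=; lia.
Qed.

End Standard.

(** * Standardization *)

(** The condition on [m] to be a monomial of the fundamental quasisymmetric
    function attached to [T], apart from the absence of the variable x_0. *)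
Definition compatible (a : seq nat) (m : monomial) (T : filling) : Prop :=
  size m = sumn a /\
  {in transpose_descents (sumn a) T, forall x, letter m x < letter m x.+1}.

(** Both tableaux order their cells in the same way by [standard_order]. *)
Lemma destandardization_inj a (m : monomial) T T' :
  RSCT a T -> standard T -> compatible a m T ->
  RSCT a T' -> standard T' -> compatible a m T' ->
  destandardization m T = destandardization m T' -> T = T'.
Proof.
move=> aT stT [sm jT] aT' stT' [_ jT'] eTT'.
have [sT sT'] : shape T = a /\ shape T' = a by case: aT => ->; case: aT' => ->.
have ord := standard_order _ _ sT stT _ aT sm jT.
have ord' := standard_order _ _ sT' stT' _ aT' sm jT'.
have inj := standard_inj _ _ sT stT; have inj' := standard_inj _ _ sT' stT'.
apply: eq_filling; rewrite sT ?sT' // => p pa.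
rewrite (standard_entryE _ _ sT stT _ pa) (standard_entryE _ _ sT' stT' _ pa).
apply/eq_in_count => q qa; case: (eqVneq q p) => [->|qp]; first by rewrite !leqnn.
have n1 : entry T q <> entry T p by move/(inj _ _ qa pa)/eqP; rewrite (negbTE qp).
have n2 : entry T' q <> entry T' p by move/(inj' _ _ qa pa)/eqP; rewrite (negbTE qp).
apply/idP/idP => h; rewrite leqNgt; apply/negP => h'; case/eqP: qp.
- apply: (cell_le_anti (entry (destandardization m T))).
    by apply: ord; lia.
  by rewrite eTT'; apply: ord'.
- apply: (cell_le_anti (entry (destandardization m T))).
    by rewrite eTT'; apply: ord'; lia.
  by apply: ord.
Qed.

(** The cells of [F] by increasing entry, ties being broken by [before]; the
    standardization numbers the cells along this list. *)
Definition reading (F : filling) : seq (nat * nat) :=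
  sort (cell_le (entry F)) (cells (shape F)).

Definition standardization (F : filling) : filling :=
  fill (shape F) (fun p => (index p (reading F)).+1).

Section Standardization.
Variable F : filling.
Let T := standardization F.

Lemma shape_standardization : shape T = shape F.
Proof. exact: shape_fill. Qed.

Lemma mem_reading p : (p \in reading F) = (p \in cells (shape F)).
Proof. exact: mem_sort. Qed.

Lemma reading_uniq : uniq (reading F).
Proof. by rewrite sort_uniq cells_uniq. Qed.

Lemma entry_standardization p : p \in cells (shape F) ->
  entry T p = (index p (reading F)).+1.
Proof. by move=> pF; rewrite entry_fill pF. Qed.

Lemma standardization_order p q : p \in cells (shape F) -> q \in cells (shape F) ->
  entry T p < entry T q -> cell_le (entry F) p q.
Proof.
move=> pF qF; rewrite !entry_standardization // ltnS.
apply: (sorted_ltn_index (cell_le_trans _)); rewrite ?mem_reading //.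
exact: (sort_sorted (cell_le_total _)).
Qed.

Lemma standardization_ltn p q : p \in cells (shape F) -> q \in cells (shape F) ->
  cell_le (entry F) p q -> p != q -> entry T p < entry T q.
Proof.
move=> pF qF pq; rewrite ltnNge; apply: contra; rewrite leq_eqVlt => /orP[|].
  rewrite !entry_standardization // eqSS => /eqP ipq.
  by rewrite -(nth_index p (_ : p \in reading F)) ?mem_reading // -ipq
     nth_index ?mem_reading.
by move/(standardization_order _ _ qF pF) => qp; apply/eqP; apply: cell_le_anti pq qp.
Qed.

Lemma standardization_standard : standard T.
Proof.
apply/eq_seq_msetP; rewrite shape_standardization flatten_fill.
apply: (@perm_trans _ [seq (index p (reading F)).+1 | p <- reading F]).
  by apply: perm_map; rewrite perm_sym perm_sort.
rewrite -size_cells -(size_sort (cell_le (entry F))) -/(reading F).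
suff -> : [seq (index p (reading F)).+1 | p <- reading F] = iota 1 (size (reading F)).
  exact: perm_refl.
apply: (@eq_from_nth _ 0); rewrite size_map ?size_iota // => i iF.
by rewrite nth_iota // (nth_map (0, 0)) // index_uniq ?reading_uniq.
Qed.

(** The entries of [F] in reading order are the sorted list of its weight. *)
Lemma letter_standardization p : p \in cells (shape F) ->
  letter (weight F) (entry T p) = entry F p.
Proof.
move=> pF; rewrite entry_standardization // /letter /=.
have -> : sort leq (weight F) = [seq entry F p | p <- reading F].
  apply: (sorted_eq leq_trans anti_leq).
  - exact: (sort_sorted leq_total).
  - rewrite sorted_map; apply: sub_sorted (sort_sorted (cell_le_total (entry F)) _).
    by move=> q r /cell_le_leq.
  - rewrite perm_sort; apply: perm_trans (perm_eq_seq_mset _) _.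
    by rewrite flatten_entry perm_sym; apply: perm_map; rewrite perm_sort.
by rewrite (nth_map p) ?index_mem ?mem_reading // nth_index ?mem_reading.
Qed.

Lemma standardizationK : destandardization (weight F) T = F.
Proof.
apply: eq_filling; rewrite shape_destandardization shape_standardization // => p pF.
by rewrite entry_destandardization letter_standardization.
Qed.

Variable a : seq nat.
Hypothesis aF : RSCT a F.

(** Cells with equal entries are read from left to right, so a transpose
    descent of the standardization separates distinct entries of [F]. *)
Lemma standardization_compatible : compatible a (weight F) T.
Proof.
have sF : shape F = a by case: aF.
split=> [|x /mem_transpose_descents[_ [p [q [pF qF px qx qp]]]]].
  by rewrite (perm_size (perm_eq_seq_mset _)) size_flatten sF.
rewrite shape_standardization in pF qF.
have pq : cell_le (entry F) p q by apply: standardization_order; rewrite // px qx.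
rewrite -qx -px !letter_standardization //.
rewrite ltn_neqAle (cell_le_leq _ _ _ pq) andbT; apply/eqP.
by move/(cell_le_column _ _ _ pq); rewrite leqNgt qp.
Qed.

(** In the triple rule, an increase of the standardized entries from (i, k) to
    (j, k), i < j, is a strict increase in [F], as equal entries are read
    upwards in the column k > 0. The rule for [F] then gives a weak inequality
    between (i, k - 1) and (j, k), and a tie is broken in favour of the column
    on the left. *)
Lemma standardization_RSCT : all (leq 1) a -> RSCT a T.
Proof.
move=> ha.
have sF : shape F = a by case: aF.
have ltT := standardization_ltn; rewrite sF in ltT.
have ordT := standardization_order; rewrite sF in ordT.
have [pF rF cF tF] := (RSCTP _ _ sF).1 aF.
apply/(RSCTP _ _); rewrite ?shape_standardization //; split.
- by move=> p pa; rewrite entry_standardization ?sF.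
- move=> i k ka.
  have ka' : (i, k) \in cells a by move: ka; rewrite !mem_cells /=; lia.
  apply: ltT => //; first by rewrite /cell_le rF.
  by apply/eqP => -[]; lia.
- move=> i j /andP[ij ja].
  have c0 l : l < size a -> (l, 0) \in cells a.
    by move=> la; rewrite mem_cells /=; move/all_nthP: ha; apply.
  move: ij; rewrite leq_eqVlt => /orP[/eqP->//|ij].
  apply: ltnW; apply: ltT; rewrite ?c0 ?(ltn_trans ij) //.
    have := cF i j; rewrite (ltnW ij) ja => /(_ isT).
    by rewrite /cell_le /before /= (ltnW ij) andbT orbC -leq_eqVlt.
  by apply/eqP => -[]; lia.
- move=> i j k ija kn; have /andP[ij ja] := ija.
  rewrite -/(entry T (i, k)) -/(entry T (j, k)) -/(entry T (i, k.-1)).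
  have c1 : (j, k) \notin cells a -> entry T (j, k) = 0.
    by move=> h; rewrite entry_default // shape_standardization sF.
  case: (boolP ((j, k) \in cells a)) => [jk|/c1-> //].
  have c2 : (i, k) \notin cells a -> entry F (i, k) = 0.
    by move=> h; rewrite entry_default // sF.
  case: (boolP ((i, k.-1) \in cells a)) => [ik'|h _]; last first.
    by rewrite [X in X <= _]entry_default // shape_standardization sF.
  move=> Tijk.
  have Fijk : entry F (i, k) < entry F (j, k).
    case: (boolP ((i, k) \in cells a)) => [ik|/c2->]; last exact: pF.
    have := ordT _ _ ik jk Tijk.
    have [k0 ji] : (k == 0) = false /\ (j <= i) = false by lia.
    by rewrite /cell_le /before /= ltnn eqxx k0 ji !andbF orbF.
  have Fle : entry F (i, k.-1) <= entry F (j, k) := tF i j k ija kn Fijk.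
  apply/ltnW/ltT => //; last by apply/eqP => -[]; lia.
  rewrite /cell_le /before /=; lia.
Qed.

End Standardization.

(** * Coefficients *)

Import GRing.Theory.
Local Open Scope classical_set_scope.
Local Open Scope ring_scope.

(** Only the list of the variables of [m] can contribute to the coefficient. *)
Lemma monomial_qsym_coef c (m : monomial) : all (leq 1) c ->
  monomial_qsym c m = ((0%N \notin (m : seq nat)) && (c == exponents m))%:R.
Proof.
move=> cp; rewrite /monomial_qsym /series_sum.
have nz s : increasing_indices (size c) s -> monom (power_monomial c s) m != 0 ->
    [/\ 0%N \notin (m : seq nat), c = exponents m & s = variables m].
  move=> [sz sp ss]; rewrite /monom; case: (m =P _) => [->|_]; last by rewrite eqxx.
  have [-> ->] := power_monomialK _ _ sz cp ss; split=> //.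
  rewrite (perm_mem (perm_eq_seq_mset _)); apply/negP => /mem_power_word.
  by move/allP: sp => /[apply].
case: andP => [[m0 /eqP cE]|H].
  rewrite -(@fsbig_widen _ _ _ _ [set variables m]).
  - by rewrite fsbig_set1 /monom cE -power_monomial_exponents eqxx.
  - move=> _ -> /=; split; rewrite ?variables_sorted //.
      by rewrite cE size_map.
    apply/allP => x; rewrite mem_sort mem_undup => xm; rewrite lt0n.
    by apply: contra m0 => /eqP <-.
  - move=> s [si /= sm]; apply/eqP; apply: contra_notT sm => /(nz _ si).
    by case.
apply: fsbig1 => s si; apply/eqP; apply: contra_notT H => /(nz _ si)[m0 cE _].
by rewrite m0 cE.
Qed.

(** Only the composition of the exponents of [m] can contribute. *)
Lemma fundamental_qsym_coef b (m : monomial) :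
  fundamental_qsym b m =
    `[< [/\ 0%N \notin (m : seq nat), sumn (exponents m) = sumn b
          & refines (exponents m) b] >]%:R.
Proof.
set D := [set c | is_composition (sumn b) c /\ refines c b].
have finD : finite_set D.
  by apply: sub_finite_set (finite_compositions (sumn b)) => c [].
rewrite /fundamental_qsym -/D fsbig_finite // fct_sumE -fsbig_finite //.
have coef c : D c -> monomial_qsym c m =
    ((0%N \notin (m : seq nat)) && (c == exponents m))%:R.
  by move=> [/andP[cp _] _]; exact: monomial_qsym_coef.
case: asboolP => [[m0 sb rb]|H].
  rewrite -(@fsbig_widen _ _ _ _ [set exponents m]).
  - by rewrite fsbig_set1 monomial_qsym_coef ?exponents_gt0 // m0 eqxx.
  - by move=> _ -> /=; split=> //; rewrite /is_composition exponents_gt0 sb eqxx.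
  - move=> c [Dc /= cE]; rewrite coef // m0 /=; case: eqP => //.
apply: fsbig1 => c Dc; rewrite coef //; case: andP => // -[m0 /eqP cE].
by case: H; rewrite -cE; case: Dc => /andP[_ /eqP].
Qed.

Definition standard_RSCT (a : seq nat) : set filling :=
  [set T | RSCT a T /\ standard T].

Lemma finite_standard_RSCT a : finite_set (standard_RSCT a).
Proof.
apply: sub_finite_set (finite_RSCT_weight a (seq_mset (iota 1 (sumn a)))).
by move=> F [aF stF]; split=> //=; rewrite stF; case: aF => ->.
Qed.

(** Destandardization is a bijection from the standard tableaux compatible with
    [m] to the tableaux of weight [m], with inverse the standardization. *)
Lemma RS_coef a (m : monomial) : all (leq 1) a ->
  RS a m = \sum_(T \in standard_RSCT a)
    (`[< 0%N \notin (m : seq nat) /\ compatible a m T >]%:R : int).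
Proof.
move=> ha; pose good := [set T | 0%N \notin (m : seq nat) /\ compatible a m T].
rewrite (eq_fsbigr (fun T => if T \in good then 1 else 0 : int)) => [|T _]; last first.
  by rewrite /good; case: asboolP => [|] h; [rewrite mem_set|rewrite memNset].
rewrite -fsbig_mkcondr.
rewrite -(@fsbig_image _ _ _ _ _ _ (destandardization m) (fun=> 1 : int)); last first.
  move=> T T' /set_mem[[aT stT] [_ cT]] /set_mem[[aT' stT'] [_ cT']].
  exact: (destandardization_inj a m).
have -> : destandardization m @` (standard_RSCT a `&` good) =
          RSCT a `&` [set F | weight F = m].
  apply/seteqP; split=> [_ [T [[aT stT] [m0 [sm jT]]] <-]|F [aF /= wF]].
    have sT : shape T = a by case: aT.
    split; first exact: destandardization_RSCT.
    exact: destandardization_weight sT _ _ _.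
  exists (standardization F); last by rewrite -wF standardizationK.
  split; first by split; [exact: standardization_RSCT|exact: standardization_standard].
  rewrite /good -wF; split; last exact: standardization_compatible.
  rewrite (perm_mem (perm_eq_seq_mset _)); apply/flattenP => -[r rF].
  by case: aF => _ /allP/(_ _ rF)/allP h _ _ _ /h.
rewrite fsbig_mkcondr; apply: eq_fsbigr => F _.
rewrite /monom eq_sym; case: eqP => wF; first by rewrite mem_set.
by rewrite memNset.
Qed.

Definition descent_composition (n : nat) (T : filling) : seq nat :=
  composition_of_set n (transpose_descents n T).

Lemma transpose_descents_range n T :
  {in transpose_descents n T, forall x, (0 < x < n)%N}.
Proof. by move=> x /mem_transpose_descents[]. Qed.

(** The multiplicity is spread over the tableaux it counts, so that the sums over
    compositions and over tableaux can be exchanged. *)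
Lemma mulrn_dcoef (x : int) a b : x *+ dcoef a b =
  \sum_(T \in standard_RSCT a)
    if b == descent_composition (sumn a) T then x else 0.
Proof.
have -> : x *+ dcoef a b = \sum_(T \in dset a b) x.
  rewrite fsbig_finite; last exact: finite_dset.
  by rewrite big_const_seq iter_addr_0 count_predT.
have -> : dset a b = standard_RSCT a `&`
    [set T | b = descent_composition (sumn a) T].
  by apply/seteqP; split=> [T [aT stT bT]|T [[aT stT] /= bT]]; split.
rewrite fsbig_mkcondr; apply: eq_fsbigr => T _.
by case: eqP => bT; [rewrite mem_set|rewrite memNset].
Qed.

Theorem proposition4p2 (n : nat) (a : seq nat) (ha : is_composition n a) :
  RS a = \sum_(b \in [set b | is_composition n b])
           fundamental_qsym b *+ dcoef a b.
Proof.
have /andP[ap /eqP sa] := ha.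
apply/funext => m; rewrite fsbig_finite; last exact: finite_compositions.
rewrite fct_sumE.
under eq_bigr => b _.
  have -> : (fundamental_qsym b *+ dcoef a b) m = fundamental_qsym b m *+ dcoef a b.
    by elim: (dcoef a b) => // k IH; rewrite !mulrS -IH.
  rewrite mulrn_dcoef fsbig_finite; last exact: finite_standard_RSCT.
  over.
(* A tableau contributes only to the composition of its own descent set. *)
rewrite exchange_big RS_coef // fsbig_finite; last exact: finite_standard_RSCT.
apply: eq_bigr => T _; rewrite sa.
have Sn := transpose_descents_range n T.
have bn := composition_of_setP _ _ Sn.
rewrite (bigD1_seq (descent_composition n T)) ?fset_uniq //=; last first.
  by rewrite in_fset_set ?inE //; exact: finite_compositions.
rewrite eqxx big1 => [|b /negbTE-> //]; rewrite addr0 fundamental_qsym_coef.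
congr (nat_of_bool _)%:R; apply: asbool_equiv_eq.
have /andP[_ /eqP sb] := bn.
have := refines_exponents _ _ m Sn.
rewrite /compatible sa /descent_composition sb => -[H1 H2].
by split=> [[m0 /H2[]]|[m0 s r]] //; split=> //; apply: H1.
Qed.
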